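(* Let $A\in\mathbb{R}^{n\times n}$ with $\rho(A)<1$, $C\in\mathbb{R}^{m\times n}$, and $Q\in\mathbb{R}^{n\times n}$, $R\in\mathbb{R}^{m\times m}$ symmetric positive definite, with $(A,C)$ observable and $(A,Q^{1/2})$ controllable. Let $\bar P$ be the unique stabilizing positive definite solution of $$\bar P = A\bar PA^{\intercal}+Q-(A\bar PA^{\intercal}+Q)C^{\intercal}\big(C(A\bar PA^{\intercal}+Q)C^{\intercal}+R\big)^{-1}C(A\bar PA^{\intercal}+Q),$$ let $P^{OP}=L(A,Q)$ and $P_n=P^{OP}+\bar P$. Let $0\le\bar\gamma<1$ and $0\le\gamma^e<1$. For $\mu\in(0,1)$: (i) let $(\lambda_k)_{k\ge1}$ be i.i.d. $\{0,1\}$-valued with $\mathbb{P}[\lambda_k=0]=\bar\gamma$, $(\lambda^e_k)_{k\ge1}$ i.i.d. $\{0,1\}$-valued with $\mathbb{P}[\lambda^e_k=0]=\gamma^e$, and $(u_k)_{k\ge1}$ i.i.d. $\{0,1\}$-valued with $\mathbb{P}[u_k=0]=\mu$, with $(u_k)$ independent of $(\lambda_k)$ and of $(\lambda^e_k)$; (ii) with fixed symmetric positive semidefinite $P_0,P^e_0$, define for $k\ge1$: $P_k=\bar P$ if $(\lambda_k,u_k)=(1,1)$ and $P_k=AP_{k-1}A^{\intercal}+Q$ otherwise; and $P^e_k=\bar P$ if $(\lambda^e_k,u_k)=(1,1)$, $P^e_k=P_n$ if $(\lambda^e_k,u_k)=(1,0)$, and $P^e_k=AP^e_{k-1}A^{\intercal}+Q$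 if $\lambda^e_k=0$; (iii) let $J(\mu)=\operatorname{tr}\lim_{k\to\infty}\mathbb{E}[P_k]$ and $J^e(\mu)=\operatorname{tr}\lim_{k\to\infty}\mathbb{E}[P^e_k]$. Let $W^e=L(\sqrt{\gamma^e}A,\bar P)$, $S^e=L(\sqrt{\gamma^e}A,Q)$, $H^e=L(\sqrt{\gamma^e}A,P_n)$ and $$\mu^{OP}=\frac{\gamma^e(\operatorname{tr}S^e-\operatorname{tr}W^e)+\operatorname{tr}W^e-\operatorname{tr}P^{OP}}{(\gamma^e-1)(\operatorname{tr}H^e-\operatorname{tr}W^e)}.$$ If $\mu\in(0,1)$ satisfies $\mu^{OP}<\mu<1$, then $J(\mu)<\operatorname{tr}P^{OP}$ and $\operatorname{tr}P^{OP}<J^e(\mu)$.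
   Context: For a square matrix $T$ with $\rho(T)<1$ and a symmetric matrix $U$, $L(T,U)$ denotes the unique solution $V$ of $V=TVT^{\intercal}+U$, equivalently $L(T,U)=\sum_{j=0}^{\infty}T^jU(T^{\intercal})^j$. Interpretation: a sensor transmits its steady-state Kalman estimate (error covariance $\bar P$) or, with probability $\mu$ (pseudo-random indicator $u_k=0$, known to the legitimate user but not the eavesdropper), independent noise with covariance $\bar P$; $P_k$ is the legitimate user's error covariance (dropout probability $\bar\gamma$), $P^e_k$ the eavesdropper's (dropout probability $\gamma^e$), and $P^{OP}$ the open-loop prediction error covariance. *)

(* Defs.v *)
From HB Require Import structures.
From mathcomp Require Import all_boot all_order all_algebra.
From mathcomp Require Import all_classical all_reals all_analysis.
From mathcomp.real_closed Require Import complex.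
Set Implicit Arguments. Unset Strict Implicit. Unset Printing Implicit Defensive.
Import Order.TTheory GRing.Theory Num.Theory.
Local Open Scope ring_scope.
Local Open Scope classical_set_scope.

Section Defs.
Variable R : realType.

Definition cmx m n (A : 'M[R]_(m, n)) : 'M[R[i]]_(m, n) := map_mx (fun x => (x%:C)%C) A.

Definition spec_rad_lt1 n (A : 'M[R]_n) : Prop :=
  forall z : R[i], eigenvalue (cmx A) z -> `|z| < 1.

Definition sym_mx n (M : 'M[R]_n) : Prop := M^T = M.

Definition psd_mx n (M : 'M[R]_n) : Prop :=
  sym_mx M /\ forall v : 'cV[R]_n, 0 <= (v^T *m M *m v) 0 0.

Definition pd_mx n (M : 'M[R]_n) : Prop :=
  sym_mx M /\ forall v : 'cV[R]_n, v != 0 -> 0 < (v^T *m M *m v) 0 0.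

Definition observable n m (A : 'M[R]_n) (C : 'M[R]_(m, n)) : Prop :=
  \rank (\mxcol_(i < n) (C *m A ^+ i)) = n.

Definition controllable n p (A : 'M[R]_n) (B : 'M[R]_(n, p)) : Prop :=
  \rank (\mxrow_(i < n) (A ^+ i *m B)) = n.

(* V solves the Lyapunov equation V = T V T^T + U ; when rho(T) < 1 the
   solution is unique and is L(T,U) *)
Definition is_L n (T U V : 'M[R]_n) : Prop := V = T *m V *m T^T + U.

Definition prior n (A Q P : 'M[R]_n) : 'M[R]_n := A *m P *m A^T + Q.

Definition kgain n m (A Q : 'M[R]_n) (C : 'M[R]_(m, n)) (Rn : 'M[R]_m)
  (P : 'M[R]_n) : 'M[R]_(n, m) :=
  prior A Q P *m C^T *m invmx (C *m prior A Q P *m C^T + Rn).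

Definition riccati n m (A Q : 'M[R]_n) (C : 'M[R]_(m, n)) (Rn : 'M[R]_m)
  (P : 'M[R]_n) : Prop :=
  P = prior A Q P - prior A Q P *m C^T *m invmx (C *m prior A Q P *m C^T + Rn)
        *m C *m prior A Q P.

Definition stabilizing n m (A Q : 'M[R]_n) (C : 'M[R]_(m, n)) (Rn : 'M[R]_m)
  (P : 'M[R]_n) : Prop :=
  spec_rad_lt1 ((1%:M - kgain A Q C Rn P *m C) *m A).

(* legitimate user's covariance recursion; index k here stands for time k
   (P_0 given) and lam k, u k stand for lambda_{k+1}, u_{k+1} *)
Fixpoint Pseq (T : Type) n (A Q Pbar P0 : 'M[R]_n) (lam u : nat -> T -> bool)
  (k : nat) (t : T) : 'M[R]_n :=
  match k with
  | 0 => P0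
  | k'.+1 => if lam k' t && u k' t then Pbar
             else A *m Pseq A Q Pbar P0 lam u k' t *m A^T + Q
  end.

Fixpoint Peseq (T : Type) n (A Q Pbar Pn Pe0 : 'M[R]_n) (lame u : nat -> T -> bool)
  (k : nat) (t : T) : 'M[R]_n :=
  match k with
  | 0 => Pe0
  | k'.+1 => if lame k' t then (if u k' t then Pbar else Pn)
             else A *m Peseq A Q Pbar Pn Pe0 lame u k' t *m A^T + Q
  end.

Section Prob.
Context d (T : measurableType d) (Pr : probability T R).

Local Open Scope ereal_scope.

Definition mutual_indep (E : nat -> set T) : Prop :=
  forall s : seq nat, uniq s ->
    Pr (\bigcap_(i in [set` s]) E i) = \prod_(i <- s) Pr (E i).

(* independence of the sigma-algebras generated by two sequences of events
   (checked on the generating pi-systems of finite intersections) *)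
Definition indep_seqs (E F : nat -> set T) : Prop :=
  forall s r : seq nat,
    Pr (\bigcap_(i in [set` s]) E i `&` \bigcap_(j in [set` r]) F j) =
    Pr (\bigcap_(i in [set` s]) E i) * Pr (\bigcap_(j in [set` r]) F j).

Definition iid_bernoulli (x : nat -> T -> bool) (p : R) : Prop :=
  (forall k, measurable [set t | x k t]) /\
  mutual_indep (fun k => [set t | x k t]) /\
  (forall k, Pr [set t | ~~ x k t] = p%:E).

Definition Emx_cvg n (X : nat -> T -> 'M[R]_n) (M : 'M[R]_n) : Prop :=
  forall i j : 'I_n,
    (fun k => \int[Pr]_t (X k t i j)%:E) @ \oo --> (M i j)%:E.

End Prob.
End Defs.

(* Main.v *)
(* Once [A ^+ k --> 0] is extracted from the spectral radius hypothesis (by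
   Cayley-Hamilton and induction on the list of eigenvalues), a solution [V] of
   [V = T V T^T + U] with [T ^+ k --> 0] and [U] positive semidefinite satisfies
   [V >= U], hence [tr V >= tr U].  Since each transmission is independent of the
   past, the means of both covariance sequences follow affine recursions
   [M' = T M T^T + U] and converge to the corresponding Lyapunov solutions.
   For the user, with [s = (1 - mu) * (1 - gbar)], the gap to the open loop is
   [POP - Pinf = L(sqrt (1 - s) A, s (POP - Pbar))]; its trace is positive because
   the Riccati correction is nonzero ([C != 0] by observability).  For the
   eavesdropper [Peinf = (1 - ge) ((1 - mu) We + mu He) + ge Se], whose trace is
   affine in [mu] with slope [(1 - ge) tr (He - We) > 0] as
   [He - We = L(sqrt ge A, POP)]; it equals [tr POP] exactly at the threshold. *)
Require Import Defs.
From HB Require Import structures.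
From mathcomp Require Import all_boot all_order all_algebra.
From mathcomp Require Import all_classical all_reals all_analysis.
From mathcomp.real_closed Require Import complex.
From mathcomp Require Import ring lra.
Set Implicit Arguments. Unset Strict Implicit. Unset Printing Implicit Defensive.
Import Order.TTheory GRing.Theory Num.Theory Normc.
Import numFieldNormedType.Exports.
Local Open Scope ring_scope.
Local Open Scope classical_set_scope.

(** * Decay of the powers of a matrix with spectral radius below one *)

Definition mx_cvg {R : realType} {m n : nat} (X : nat -> 'M[R]_(m, n))
    (L : 'M[R]_(m, n)) : Prop :=
  forall i j, X k i j @[k --> \oo] --> L i j.

(** With [a] the modulus of [z], the gap [e = (1 - a) * (1 - r) / 2] satisfies both [r <= 1 - e] and
    [a + e <= 1 - e]. The summand [c / e] makes the constant [K] large enough for [c <= K * e], so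
    the induction step costs at most the factor [a + e]. *)
Lemma geometric_recurrence {R : realType} {z : R[i]} {x y : nat -> R[i]} {c r : R} :
  0 < r < 1 -> `|z| < 1 -> (forall k, `|y k| <= ((c * r ^+ k)%:C)%C) ->
  (forall k, x k.+1 = z * x k + y k) ->
  forall k, normc (x k) <=
    (normc (x 0%N) + c / ((1 - normc z) * (1 - r) / 2)) *
    (1 - (1 - normc z) * (1 - r) / 2) ^+ k.
Proof.
move=> /andP[r0 r1] z1 yle xS.
have {z1} : normc z < 1 by move: z1; rewrite -ltcR.
have {yle} yle k : normc (y k) <= c * r ^+ k by move: (yle k); rewrite -lecR.
have nge0 (w : R[i]) : 0 <= normc w by case: w => a b; exact: sqrtr_ge0.
set a := normc z => a1; set e := (1 - a) * (1 - r) / 2.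
have a0 : 0 <= a := nge0 z.
have e0 : 0 < e by rewrite /e; nra.
have eD : 1 - r - e = (1 - r) * (1 + a) / 2 by rewrite /e; field.
have er : r <= 1 - e by rewrite /e; nra.
have ea : a + e <= 1 - e by rewrite /e; nra.
have c0 : 0 <= c by have := le_trans (nge0 _) (yle 0%N); rewrite expr0 mulr1.
have n0 := nge0 (x 0%N).
have ce0 : 0 <= c / e by rewrite divr_ge0 // ltW.
elim=> [|k IH]; first by rewrite expr0 mulr1 lerDl.
rewrite xS; apply: le_trans (le_normcD _ _) _; rewrite normcM -/a.
have rk : r ^+ k <= (1 - e) ^+ k by rewrite lerXn2r // nnegrE; lra.
set w := (1 - e) ^+ k in IH rk *; rewrite exprS -/w.
have w0 : 0 <= w by rewrite exprn_ge0 //; lra.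
set K := normc (x 0%N) + c / e in IH *.
have K0 : 0 <= K by rewrite addr_ge0.
have h1 : c * r ^+ k <= c * w by rewrite ler_wpM2l.
have h2 : a * normc (x k) <= a * (K * w) by rewrite ler_wpM2l.
have h3 : c <= K * e by rewrite /K mulrDl divfK ?gt_eqF // lerDr mulr_ge0 // ltW.
have h4 : c * w <= K * e * w by rewrite ler_wpM2r.
have h5 : (a + e) * (K * w) <= (1 - e) * (K * w) by rewrite ler_wpM2r // mulr_ge0.
have := yle k; lra.
Qed.

(** Peeling off one root [z] gives [Y = (A - z) X], killed by the remaining factors, and
    [A ^+ k.+1 *m X] equals [z] times [A ^+ k *m X] plus [A ^+ k *m Y]: a scalar recurrence in each
    entry. The free right factor [X] is what lets the induction pass to [Y]. *)
Lemma horner_mx_decay {R : realType} {n : nat} (A : 'M[R[i]]_n.+1)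
    (s : seq R[i]) (X : 'M[R[i]]_n.+1) :
  (forall z, z \in s -> `|z| < 1) ->
  horner_mx A (\prod_(z <- s) ('X - z%:P)) *m X = 0 ->
  exists c r : R, 0 < r < 1 /\
    forall k i j, `|(A ^+ k *m X) i j| <= ((c * r ^+ k)%:C)%C.
Proof.
elim: s X => [|z s IH] X sz.
  rewrite big_nil rmorph1 mul1mx => ->; exists 0, (1 / 2); split; first lra.
  by move=> k i j; rewrite mulmx0 mxE mul0r normr0.
rewrite big_cons mulrC rmorphM /= -mulmxA => /IH[w ws|c [r [r01 cr]]].
  by apply: sz; rewrite inE ws orbT.
have z1 : `|z| < 1 by apply: sz; rewrite mem_head.
have xS i j k : (A ^+ k.+1 *m X) i j =
    z * (A ^+ k *m X) i j +
    (A ^+ k *m (horner_mx A ('X - z%:P) *m X)) i j.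
  rewrite rmorphB /= horner_mx_X horner_mx_C mulmxBl mulmxBr.
  rewrite mulmxA -[A ^+ k *m A]/(A ^+ k * A) -exprSr mul_scalar_mx -scalemxAr.
  rewrite [X in _ = _ + X]mxE [X in _ = _ + (_ + X)]mxE [X in _ = _ + (_ - X)]mxE.
  by rewrite addrCA subrr addr0.
have az1 : normc z < 1 by rewrite -ltcR.
have az0 : 0 <= normc z by case: (z) => a b; exact: sqrtr_ge0.
have bd i j := geometric_recurrence r01 z1 (fun k => cr k i j) (xS i j).
set e := (1 - normc z) * (1 - r) / 2 in bd.
(* Summing the nonnegative constants of all entries gives one constant valid for every [i] and
   [j]. *)
exists (\sum_i \sum_j (normc ((A ^+ 0 *m X) i j) + c / e)), (1 - e).
case/andP: (r01) => r0 r1.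
have c0 : 0 <= c.
  have := le_trans (normr_ge0 _) (cr 0%N ord0 ord0).
  by rewrite expr0 mulr1 lecR.
have e0 : 0 < e by rewrite /e; nra.
have e1 : e < 1 by rewrite /e; nra.
split; first by apply/andP; split; lra.
move=> k i j; have := bd i j k; rewrite -lecR => /le_trans; apply.
rewrite lecR ler_wpM2r ?exprn_ge0 //; first lra.
have nn (a b : 'I_n.+1) : 0 <= normc ((A ^+ 0 *m X) a b) + c / e.
  have ne0 : 0 <= normc ((A ^+ 0 *m X) a b).
    by case: ((A ^+ 0 *m X) a b) => x y; exact: sqrtr_ge0.
  by rewrite addr_ge0 // divr_ge0 // ltW.
rewrite (bigD1 i) //= (bigD1 j) //= -addrA lerDl addr_ge0 // ?sumr_ge0 //.
by move=> a _; rewrite sumr_ge0.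
Qed.

Lemma spec_rad_lt1_cvg0 {R : realType} {n : nat} (A : 'M[R]_n) :
  spec_rad_lt1 A -> mx_cvg (fun k => A ^+ k) 0.
Proof.
case: n A => [A _ i|n A rho]; first by case: i.
have [s sE] := closed_field_poly_normal (char_poly (cmx A)).
rewrite (monicP (char_poly_monic _)) scale1r in sE.
have sz z : z \in s -> `|z| < 1.
  by move=> zs; apply: rho; rewrite eigenvalue_root_char sE root_prod_XsubC.
have [|c [r [/andP[r0 r1] cr]]] := @horner_mx_decay _ _ (cmx A) s 1%:M sz.
  by rewrite -sE Cayley_Hamilton mul0mx.
move=> i j; rewrite mxE.
apply: (@norm_cvg0P _ _ _ _ _ _).1.
have bd k : `|(A ^+ k) i j| <= c * r ^+ k.
  have := cr k i j; have -> : cmx A ^+ k = map_mx (real_complex R) (A ^+ k).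
    by rewrite rmorphXn.
  rewrite mulmx1 mxE.
  by rewrite -lecR; congr (_ <= _); rewrite normc_def /= expr0n addr0 sqrtr_sqr.
have g0 : c * r ^+ k @[k --> \oo] --> (0 : R).
  by apply: cvg_geometric; rewrite ger0_norm ?ltW.
apply: (@squeeze_cvgr _ _ _ _ (cst 0) _ _ _ _ (cvg_cst _) g0).
by apply: nearW => k; rewrite normr_ge0 bd.
Qed.

(** The quadratic-form half of [psd_mx]: trace comparisons use only this, so symmetry need not be
    carried through Lyapunov solutions. *)
Definition nonneg_form {R : realType} {n : nat} (M : 'M[R]_n) : Prop :=
  forall v : 'cV[R]_n, 0 <= (v^T *m M *m v) 0 0.

Definition pos_form {R : realType} {n : nat} (M : 'M[R]_n) : Prop :=
  forall v : 'cV[R]_n, v != 0 -> 0 < (v^T *m M *m v) 0 0.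

(** * Entrywise limits of matrix sequences *)

Section Cvg0.
Context {R : realType}.

Lemma mx_cvg_cst m n (L : 'M[R]_(m, n)) : mx_cvg (fun=> L) L.
Proof. by move=> i j; exact: cvg_cst. Qed.

Lemma mx_cvgM m n p (X : nat -> 'M[R]_(m, n)) (Y : nat -> 'M[R]_(n, p)) L M :
  mx_cvg X L -> mx_cvg Y M -> mx_cvg (fun k => X k *m Y k) (L *m M).
Proof.
move=> XL YM i j; under eq_cvg do rewrite mxE; rewrite mxE.
by apply: cvg_big => [|l _]; [exact: add_continuous|exact: cvgM].
Qed.

Lemma mx_cvgD m n (X Y : nat -> 'M[R]_(m, n)) L M :
  mx_cvg X L -> mx_cvg Y M -> mx_cvg (fun k => X k + Y k) (L + M).
Proof.
by move=> XL YM i j; under eq_cvg do rewrite mxE; rewrite mxE; exact: cvgD.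
Qed.

Lemma mx_cvgT m n (X : nat -> 'M[R]_(m, n)) L :
  mx_cvg X L -> mx_cvg (fun k => (X k)^T) L^T.
Proof. by move=> XL i j; under eq_cvg do rewrite mxE; rewrite mxE; apply: XL. Qed.

Lemma mx_cvg0_congr n (X : nat -> 'M[R]_n) (V : 'M[R]_n) :
  mx_cvg X 0 -> mx_cvg (fun k => X k *m V *m (X k)^T) 0.
Proof.
move=> X0; have XV := mx_cvgM X0 (mx_cvg_cst (L := V)).
by have := mx_cvgM XV (mx_cvgT X0); rewrite mul0mx mul0mx.
Qed.

(** Since [(c *: A) ^+ k = c ^+ k *: A ^+ k], scaling by [c <= 1] only shrinks entries. This serves
    all the damped matrices [Num.sqrt q *: A] without a new spectral argument. *)
Lemma mx_cvg0_scale n (A : 'M[R]_n) (c : R) : 0 <= c <= 1 ->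
  mx_cvg (fun k => A ^+ k) 0 -> mx_cvg (fun k => (c *: A) ^+ k) 0.
Proof.
move=> /andP[c0 c1] A0 i j; rewrite mxE; apply: (@norm_cvg0P _ _ _ _ _ _).1.
have nA0 : `|(A ^+ k) i j| @[k --> \oo] --> (0 : R).
  by apply: (@norm_cvg0P _ _ _ _ _ _).2; have := A0 i j; rewrite mxE.
apply: (@squeeze_cvgr _ _ _ _ (cst 0) _ _ _ _ (cvg_cst _) nA0).
apply: nearW => k; rewrite normr_ge0 /=.
have -> : (c *: A) ^+ k = c ^+ k *: A ^+ k.
  elim: k => [|k IH]; first by rewrite !expr0 scale1r.
  by rewrite !exprS IH; rewrite -[_ * _ in LHS]/(_ *m _) -scalemxAl -scalemxAr scalerA.
by rewrite mxE normrM ger0_norm ?exprn_ge0 // ler_piMl // exprn_ile1.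
Qed.

End Cvg0.

(** * Quadratic forms and traces *)

Section Forms.
Context {R : realType}.

Lemma form_delta n (M : 'M[R]_n) i :
  ((delta_mx i (0 : 'I_1) : 'cV[R]_n)^T *m M *m (delta_mx i (0 : 'I_1) : 'cV[R]_n)) 0 0 = M i i.
Proof. by rewrite trmx_delta -rowE -colE !mxE. Qed.

Lemma delta_cV_neq0 n (i : 'I_n) : (delta_mx i (0 : 'I_1) : 'cV[R]_n) != 0.
Proof.
apply/negP => /eqP/matrixP/(_ i 0)/eqP.
by rewrite !mxE !eqxx oner_eq0.
Qed.

Lemma mxtrace_ge0 n (M : 'M[R]_n) : nonneg_form M -> 0 <= \tr M.
Proof. by move=> M0; apply: sumr_ge0 => i _; rewrite -form_delta. Qed.

Lemma nonneg_form_congr m n (B : 'M[R]_(m, n)) (V : 'M[R]_n) :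
  nonneg_form V -> nonneg_form (B *m V *m B^T).
Proof. by move=> V0 v; have := V0 (B^T *m v); rewrite trmx_mul trmxK !mulmxA. Qed.

Lemma pos_form_nonneg n (M : 'M[R]_n) : pos_form M -> nonneg_form M.
Proof.
move=> M0 v; have [->|/M0/ltW//] := eqVneq v 0.
by rewrite mulmx0 mxE.
Qed.

Lemma formD n (M N : 'M[R]_n) (v : 'cV[R]_n) :
  (v^T *m (M + N) *m v) 0 0 = (v^T *m M *m v) 0 0 + (v^T *m N *m v) 0 0.
Proof. by rewrite mulmxDr mulmxDl mxE. Qed.

Lemma nonneg_pos_formD n (M N : 'M[R]_n) :
  nonneg_form M -> pos_form N -> pos_form (M + N).
Proof. by move=> M0 N0 v v0; rewrite formD ltr_wpDl // N0. Qed.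

Lemma pos_form_unitmx n (M : 'M[R]_n) : pos_form M -> M \in unitmx.
Proof.
move=> M0; rewrite -row_free_unit -kermx_eq0; apply/rowV0P => v /sub_kermxP vM.
apply/eqP/negPn/negP => v0; have := M0 v^T.
by rewrite trmx_eq0 trmxK vM mul0mx mxE ltxx => /(_ v0).
Qed.

Lemma pos_form_inv n (M : 'M[R]_n) : M^T = M -> pos_form M -> pos_form (invmx M).
Proof.
move=> symM M0 v v0; have uM := pos_form_unitmx M0.
have := M0 (invmx M *m v); rewrite trmx_mul trmx_inv symM !mulmxA mulmxKV //.
apply; apply: contra v0 => /eqP e.
by rewrite -[v](mulKVmx uM) e mulmx0.
Qed.

Lemma mxtrace_pos n (M : 'M[R]_n) : (0 < n)%N -> pos_form M -> 0 < \tr M.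
Proof.
case: n M => // n M _ M0; rewrite /mxtrace (bigD1 ord0) //=.
have d0 i : 0 < M i i by rewrite -form_delta M0 ?delta_cV_neq0.
by rewrite ltr_pwDl // sumr_ge0 // => i _; rewrite ltW.
Qed.

(** A nonzero row of [B] produces a positive diagonal entry, and the other diagonal entries are
    nonnegative. [B] may be rank-deficient, so the product itself need not be definite. *)
Lemma mxtrace_congr_pos m n (B : 'M[R]_(n, m)) (M : 'M[R]_m) :
  B != 0 -> pos_form M -> 0 < \tr (B *m M *m B^T).
Proof.
move=> B0 M0; have /pos_form_nonneg/(nonneg_form_congr B) BMB := M0.
have [i Bi] : exists i, row i B != 0.
  apply/existsP; apply: contraR B0; rewrite negb_exists => /forallP H.
  apply/eqP/row_matrixP => i; rewrite row0; apply/eqP/negPn/H.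
rewrite /mxtrace (bigD1 i) //= ltr_pwDl ?sumr_ge0 //; last first.
  by move=> j _; rewrite -form_delta.
rewrite -form_delta -(trmxK (delta_mx i 0)) trmx_delta.
have := M0 (row i B)^T; rewrite trmx_eq0 trmxK => /(_ Bi).
by rewrite rowE trmx_mul trmxK !mulmxA.
Qed.

End Forms.

(** * Lyapunov equations, without infinite series *)

Section Lyapunov.
Context {R : realType} {n : nat}.
Implicit Types T U V : 'M[R]_n.

Lemma is_L_scaleD T U V U' V' (a b : R) :
  is_L T U V -> is_L T U' V' -> is_L T (a *: U + b *: U') (a *: V + b *: V').
Proof.
rewrite /is_L => e e'; rewrite {1}e {1}e' !scalerDr mulmxDr mulmxDl.
by rewrite -!scalemxAr -!scalemxAl addrACA.
Qed.

Lemma congr_sqrt (A V : 'M[R]_n) (q : R) : 0 <= q ->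
  (Num.sqrt q *: A) *m V *m (Num.sqrt q *: A)^T = q *: (A *m V *m A^T).
Proof.
move=> q0; rewrite linearZ /= -!scalemxAl -scalemxAr scalerA -expr2.
by rewrite sqr_sqrtr.
Qed.

(** Substituting the equation for [V] splits the form at [k] into the form at [k.+1] plus a
    congruence of [U], so the forms decrease in [k]. *)
Lemma is_L_pow T U V : is_L T U V -> nonneg_form U ->
  forall k (v : 'cV[R]_n),
  (v^T *m (T ^+ k *m V *m (T ^+ k)^T) *m v) 0 0 <= (v^T *m V *m v) 0 0.
Proof.
move=> TUV U0; elim=> [|k IH] v; first by rewrite expr0 trmx1 mul1mx mulmx1.
apply: le_trans (IH v); rewrite {2}TUV mulmxDr mulmxDl formD.
have -> : T ^+ k *m (T *m V *m T^T) *m (T ^+ k)^T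
   = T ^+ k.+1 *m V *m (T ^+ k.+1)^T.
  by rewrite exprSr -[_ * _]/(_ *m _) trmx_mul !mulmxA.
by rewrite lerDl; exact: nonneg_form_congr.
Qed.

(** The form of [V] dominates, for every [k], a quantity that tends to zero. *)
Lemma is_L_nonneg T U V : mx_cvg (fun k => T ^+ k) 0 ->
  is_L T U V -> nonneg_form U -> nonneg_form V.
Proof.
move=> T0 TUV U0 v.
have := mx_cvgM (mx_cvgM (mx_cvg_cst (L := v^T))
  (mx_cvg0_congr V T0)) (mx_cvg_cst (L := v)).
move=> /(_ 0 0); rewrite mulmx0 mul0mx mxE => c0.
apply: (ler_cvg_to c0 (cvg_cst ((v^T *m V *m v) 0 0))).
by apply: nearW => k; exact: is_L_pow TUV U0 k v.
Qed.

Lemma is_L_mxtrace T U V : mx_cvg (fun k => T ^+ k) 0 ->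
  is_L T U V -> nonneg_form U -> \tr U <= \tr V.
Proof.
move=> T0 TUV U0; rewrite [in leRHS]TUV mxtraceD lerDr mxtrace_ge0 //.
exact/nonneg_form_congr/is_L_nonneg/U0.
Qed.

(** The error [M k - V] obeys the homogeneous recursion, hence is a congruence of the initial error
    by [T ^+ k]. Applied to a constant sequence, this also yields uniqueness. *)
Lemma is_L_iter T U V (M : nat -> 'M[R]_n) : mx_cvg (fun k => T ^+ k) 0 ->
  is_L T U V -> (forall k, M k.+1 = T *m M k *m T^T + U) ->
  mx_cvg M V.
Proof.
move=> T0 TUV MS.
have ME k : M k = T ^+ k *m (M 0%N - V) *m (T ^+ k)^T + V.
  elim: k => [|k IH]; first by rewrite expr0 trmx1 mul1mx mulmx1 subrK.
  rewrite MS IH mulmxDr mulmxDl -addrA -TUV; congr (_ + _).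
  by rewrite exprS -[_ * _]/(_ *m _) trmx_mul !mulmxA.
have -> : M = (fun k => T ^+ k *m (M 0%N - V) *m (T ^+ k)^T + V).
  exact/funext.
rewrite -[X in mx_cvg _ X]add0r; apply: mx_cvgD; last exact: mx_cvg_cst.
exact: mx_cvg0_congr.
Qed.

(** The linear map [V - T V T^T] on a finite-dimensional space is injective, hence invertible: a
    kernel element is a constant orbit of the iteration with [U = 0], which converges to zero. *)
Lemma is_L_exists T U : mx_cvg (fun k => T ^+ k) 0 -> exists V, is_L T U V.
Proof.
move=> T0; pose f V := V - T *m V *m T^T.
have lf : linear f.
  move=> a V W; rewrite /f mulmxDr mulmxDl -scalemxAr -scalemxAl.
  by rewrite scalerBr opprD addrACA.
pose F : {linear 'M[R]_n -> 'M[R]_n} :=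
  HB.pack f (GRing.isLinear.Build _ _ _ _ f lf).
have uF : lin_mx F \in unitmx.
  rewrite -row_free_unit -kermx_eq0; apply/rowV0P => v /sub_kermxP.
  rewrite mul_rV_lin => /(canRL mxvecK); rewrite linear0 /= /f => /subr0_eq e.
  have L0 : is_L T 0 0 by rewrite /is_L mulmx0 mul0mx addr0.
  have eS (k : nat) : vec_mx v = T *m vec_mx v *m T^T + 0 by rewrite addr0.
  have v0 := is_L_iter (M := fun=> vec_mx v) T0 L0 eS.
  rewrite -[v]vec_mxK (_ : vec_mx v = 0) ?linear0 //; apply/matrixP => i j.
  by have /(cvg_lim (@norm_hausdorff _ _)) <- := v0 i j; rewrite lim_cst.
exists (vec_mx (mxvec U *m invmx (lin_mx F))).
set V := vec_mx _.
have : f V = U by rewrite -[f V]/(F V) -mx_rV_lin mulmxKV // mxvecK.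
by rewrite /f /is_L => <-; rewrite addrC subrK.
Qed.

End Lyapunov.

(** * Means of random variables independent of future transmissions *)

Section Expectation.
Context {R : realType} {d : measure_display} {T : measurableType d}
  (Pr : probability T R) (u v : nat -> T -> bool) (pu pv : R).
Hypothesis iidu : iid_bernoulli Pr u pu.
Hypothesis iidv : iid_bernoulli Pr v pv.
Hypothesis indep : indep_seqs Pr (fun k => [set t | u k t]) (fun k => [set t | v k t]).

(** Only successes are prescribed: these are the events on which [indep_seqs] is stated, and they
    are closed under intersection by concatenating lists. *)
Definition cylinder (s r : seq nat) : set T :=
  [set t | all (u^~ t) s && all (v^~ t) r].

Lemma mem_cylinder s r t :
  (t \in cylinder s r) = all (u^~ t) s && all (v^~ t) r.
Proof. by apply/idP/idP => [/set_mem|/mem_set]. Qed.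

Lemma cylinderE s r : cylinder s r =
  \bigcap_(i in [set` s]) [set t | u i t] `&` \bigcap_(j in [set` r]) [set t | v j t].
Proof.
apply/seteqP; split => t /=.
  by move=> /andP[/allP us /allP vr]; split => i /=; [exact: us|exact: vr].
by move=> [us vr]; apply/andP; split; apply/allP => i; [exact: us|exact: vr].
Qed.

Lemma measurable_cylinder s r : measurable (cylinder s r).
Proof.
rewrite cylinderE !bigcap_seq; apply: measurableI.
  by apply: bigsetI_measurable => i _; have [] := iidu.
by apply: bigsetI_measurable => i _; have [] := iidv.
Qed.

Lemma iid_bernoulli_all (x : nat -> T -> bool) (p : R) (s : seq nat) :
  iid_bernoulli Pr x p -> uniq s ->
  Pr (\bigcap_(i in [set` s]) [set t | x i t]) = ((1 - p) ^+ size s)%:E.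
Proof.
move=> [mx [indx px]] us; rewrite indx //.
have Px k : Pr [set t | x k t] = (1 - p)%:E.
  have -> : [set t | x k t] = ~` [set t | ~~ x k t].
    by apply/seteqP; split => t /=; case: (x k t).
  rewrite probability_setC ?px //.
  have -> : [set t | ~~ x k t] = ~` [set t | x k t].
    by apply/seteqP; split => t /=; case: (x k t).
  exact: measurableC.
elim: s {us} => [|k s IH]; first by rewrite big_nil expr0.
by rewrite big_cons IH Px -EFinM exprS.
Qed.

Lemma probability_cylinder s r : uniq s -> uniq r ->
  Pr (cylinder s r) = ((1 - pu) ^+ size s * (1 - pv) ^+ size r)%:E.
Proof.
by move=> us ur; rewrite cylinderE indep !(iid_bernoulli_all iidu, iid_bernoulli_all iidv).
Qed.

(* [X] is independent of the future from time [k] on and has mean [c]. *)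
Definition mean_indep (k : nat) (X : T -> R) (c : R) : Prop :=
  Pr.-integrable setT (EFin \o X) /\
  forall s r, uniq s -> uniq r -> all (leq k) s -> all (leq k) r ->
  (\int[Pr]_(t in cylinder s r) (X t)%:E =
    ((1 - pu) ^+ size s * (1 - pv) ^+ size r * c)%:E)%E.

Lemma mean_indep_cst k c : mean_indep k (cst c) c.
Proof.
split; first exact: finite_measure_integrable_cst.
move=> s r us ur _ _.
have := integral_cst Pr (measurable_cylinder s r) c%:E => /= ->.
by rewrite probability_cylinder // -EFinM mulrC.
Qed.

Lemma mean_indepD k X Y a b : mean_indep k X a -> mean_indep k Y b ->
  mean_indep k (fun t => X t + Y t) (a + b).
Proof.
move=> [iX eX] [iY eY]; split; first exact: (integrableD measurableT iX iY).
move=> s r us ur ks kr.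
have mC := measurable_cylinder s r.
have sC : cylinder s r `<=` setT by [].
have := integralD mC (integrableS measurableT mC sC iX) (integrableS measurableT mC sC iY).
by rewrite /= eX // eY // -EFinD -mulrDr.
Qed.

Lemma mean_indepZ k X c (a : R) : mean_indep k X c ->
  mean_indep k (fun t => a * X t) (a * c).
Proof.
move=> [iX eX]; split; first exact: (integrableZl measurableT a iX).
move=> s r us ur ks kr.
have mC := measurable_cylinder s r.
have sC : cylinder s r `<=` setT by [].
have := integralZl mC (integrableS measurableT mC sC iX) a.
by rewrite /= eX // -EFinM mulrCA.
Qed.

Lemma mean_indep_sum (I : Type) (q : seq I) k (X : I -> T -> R) (c : I -> R) :
  (forall i, mean_indep k (X i) (c i)) ->
  mean_indep k (fun t => \sum_(i <- q) X i t) (\sum_(i <- q) c i).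
Proof.
move=> Xc; elim: q => [|i q IH].
  rewrite big_nil; rewrite (_ : (fun=> _) = cst 0) ?funeqE; last by move=> t; rewrite big_nil.
  exact: mean_indep_cst.
rewrite big_cons (_ : (fun t => _) = (fun t => X i t + \sum_(i <- q) X i t)).
  exact: mean_indepD.
by apply/funext => t; rewrite big_cons.
Qed.

Lemma mean_indepS k X c : mean_indep k X c -> mean_indep k.+1 X c.
Proof.
move=> [iX eX]; split=> // s r us ur ks kr; apply: eX => //.
  by apply/allP => i /(allP ks) /ltnW.
by apply/allP => i /(allP kr) /ltnW.
Qed.

(** Intersecting a cylinder at time [k] with one after time [k] gives a cylinder from [k] on, to
    which the hypothesis on [X] applies. Each of [s0] and [r0] is thus empty or [[:: k]]. *)
Lemma mean_indep_restrict k X c s0 r0 : uniq s0 -> uniq r0 ->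
  all (eq_op k) s0 -> all (eq_op k) r0 -> mean_indep k X c ->
  mean_indep k.+1 (fun t => (t \in cylinder s0 r0)%:R * X t)
    ((1 - pu) ^+ size s0 * (1 - pv) ^+ size r0 * c).
Proof.
move=> us0 ur0 ks0 kr0 [iX eX].
have mC := measurable_cylinder s0 r0.
have XE : EFin \o (fun t => (t \in cylinder s0 r0)%:R * X t) =
    (EFin \o X) \_ (cylinder s0 r0).
  by apply/funext => t; rewrite /patch /=; case: ifP => _; rewrite (mul1r, mul0r).
split.
  rewrite XE; apply/(integrable_mkcond _ mC).
  by apply: integrableS iX.
move=> s r us ur ks kr.
have -> : (\int[Pr]_(t in cylinder s r) ((t \in cylinder s0 r0)%:R * X t)%:E =
    \int[Pr]_(t in cylinder (s0 ++ s) (r0 ++ r)) (X t)%:E)%E.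
  have -> : cylinder (s0 ++ s) (r0 ++ r) = cylinder s r `&` cylinder s0 r0.
    apply/seteqP; rewrite /cylinder; split => t /=; rewrite !all_cat.
      by move=> /andP[/andP[-> ->] /andP[-> ->]].
    by move=> [/andP[-> ->] /andP[-> ->]].
  rewrite integral_mkcondr; apply: eq_integral => t _.
  by rewrite -[RHS]/(((EFin \o X) \_ _) t) -XE.
(* Indices equal to [k] and indices beyond [k] cannot collide, so no success is counted twice. *)
have disj (q q0 : seq nat) : uniq q0 -> uniq q -> all (eq_op k) q0 ->
    all (leq k.+1) q -> uniq (q0 ++ q).
  move=> uq0 uq kq0 kq; rewrite cat_uniq uq0 uq andbT /=.
  apply/hasPn => i /(allP kq) ki; apply/negP => /(allP kq0)/eqP e.
  by rewrite e ltnn in ki.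
have ge_k (q q0 : seq nat) : all (eq_op k) q0 ->
    all (leq k.+1) q -> all (leq k) (q0 ++ q).
  move=> kq0 kq; rewrite all_cat; apply/andP; split; apply/allP => i.
    by move=> /(allP kq0)/eqP ->.
  by move=> /(allP kq)/ltnW.
rewrite eX ?disj ?ge_k // !size_cat !exprD; congr EFin; ring.
Qed.

(** * Mean recursions for the random covariance matrices *)

Definition mx_mean_indep n (k : nat) (X : T -> 'M[R]_n) (M : 'M[R]_n) : Prop :=
  forall i j, mean_indep k (fun t => X t i j) (M i j).

Lemma mx_mean_indep_cst n k (M : 'M[R]_n) : mx_mean_indep k (fun=> M) M.
Proof. by move=> i j; exact: mean_indep_cst. Qed.

Lemma mx_mean_indepD n k (X Y : T -> 'M[R]_n) M N :
  mx_mean_indep k X M -> mx_mean_indep k Y N ->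
  mx_mean_indep k (fun t => X t + Y t) (M + N).
Proof.
move=> XM YN i j; rewrite mxE; under eq_fun do rewrite mxE.
exact: mean_indepD.
Qed.

Lemma mx_mean_indepZ n k (X : T -> 'M[R]_n) M (a : R) :
  mx_mean_indep k X M -> mx_mean_indep k (fun t => a *: X t) (a *: M).
Proof.
move=> XM i j; rewrite mxE; under eq_fun do rewrite mxE.
exact: mean_indepZ.
Qed.

Lemma mx_mean_indepMl n k (X : T -> 'M[R]_n) M (A : 'M[R]_n) :
  mx_mean_indep k X M -> mx_mean_indep k (fun t => A *m X t) (A *m M).
Proof.
move=> XM i j; rewrite mxE; under eq_fun do rewrite mxE.
by apply: mean_indep_sum => l; exact: mean_indepZ.
Qed.

Lemma mx_mean_indepMr n k (X : T -> 'M[R]_n) M (A : 'M[R]_n) :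
  mx_mean_indep k X M -> mx_mean_indep k (fun t => X t *m A) (M *m A).
Proof.
move=> XM i j; rewrite mxE; under eq_fun do rewrite mxE.
apply: mean_indep_sum => l; rewrite mulrC; under eq_fun do rewrite mulrC.
exact: mean_indepZ.
Qed.

Lemma mx_mean_indep_congr n k (X : T -> 'M[R]_n) M (A B : 'M[R]_n) :
  mx_mean_indep k X M ->
  mx_mean_indep k (fun t => A *m X t *m A^T + B) (A *m M *m A^T + B).
Proof.
move=> XM; apply: mx_mean_indepD; last exact: mx_mean_indep_cst.
exact/mx_mean_indepMr/mx_mean_indepMl.
Qed.

Lemma mx_mean_indepS n k (X : T -> 'M[R]_n) M :
  mx_mean_indep k X M -> mx_mean_indep k.+1 X M.
Proof. by move=> XM i j; exact: mean_indepS. Qed.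

Lemma mx_mean_indep_restrict n k (X : T -> 'M[R]_n) M s0 r0 :
  uniq s0 -> uniq r0 -> all (eq_op k) s0 -> all (eq_op k) r0 ->
  mx_mean_indep k X M ->
  mx_mean_indep k.+1 (fun t => (t \in cylinder s0 r0)%:R *: X t)
    (((1 - pu) ^+ size s0 * (1 - pv) ^+ size r0) *: M).
Proof.
move=> ? ? ? ? XM i j; rewrite mxE; under eq_fun do rewrite mxE.
exact: mean_indep_restrict.
Qed.

Lemma mx_mean_indep_Emx n (X : nat -> T -> 'M[R]_n) (M : nat -> 'M[R]_n) V :
  (forall k, mx_mean_indep k (X k) (M k)) -> mx_cvg M V -> Emx_cvg Pr X V.
Proof.
move=> XM MV i j.
have -> : (fun k => \int[Pr]_t (X k t i j)%:E)%E = (fun k => (M k i j)%:E).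
  (* Empty lists give the whole space, with both probability factors equal to one. *)
  apply/funext => k; have [_ /(_ [::] [::] isT isT isT isT)] := XM k i j.
  by rewrite /= !mul1r => <-; congr (integral _ _ _); apply/seteqP.
by apply: cvg_EFin; [exact: nearW|exact: MV].
Qed.

(** The state at [k] depends on indicators of index below [k] only, so index [k] still counts as
    future. The case split is rewritten as [F] plus an indicator times [Pbar - F], which involves
    success events only. *)
Lemma mx_mean_indep_Pseq n (A Q Pbar P0 : 'M[R]_n) (M : nat -> 'M[R]_n) :
  M 0%N = P0 ->
  (forall k, M k.+1 = ((1 - pu) * (1 - pv)) *: Pbar +
     (1 - (1 - pu) * (1 - pv)) *: (A *m M k *m A^T + Q)) ->
  forall k, mx_mean_indep k (Pseq A Q Pbar P0 v u k) (M k).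
Proof.
move=> M0 MS; elim=> [|k IH]; first by rewrite M0; exact: mx_mean_indep_cst.
set F := fun t => A *m Pseq A Q Pbar P0 v u k t *m A^T + Q.
have HF : mx_mean_indep k F (A *m M k *m A^T + Q) by exact: mx_mean_indep_congr.
have -> : Pseq A Q Pbar P0 v u k.+1 = fun t =>
    (t \in cylinder [:: k] [:: k])%:R *: (Pbar + (-1) *: F t) + F t.
  apply/funext => t /=; rewrite mem_cylinder /= !andbT andbC.
  by case: ifP => _; rewrite (scale1r, scale0r) ?add0r // scaleN1r subrK.
have -> : M k.+1 = ((1 - pu) ^+ 1 * (1 - pv) ^+ 1) *:
    (Pbar + (-1) *: (A *m M k *m A^T + Q)) + (A *m M k *m A^T + Q).
  by rewrite MS; apply/matrixP => i j; rewrite !mxE; ring.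
apply: mx_mean_indepD; last exact: mx_mean_indepS.
apply: mx_mean_indep_restrict; rewrite /= ?eqxx //.
by apply: mx_mean_indepD; [exact: mx_mean_indep_cst|exact: mx_mean_indepZ].
Qed.

Lemma mx_mean_indep_Peseq n (A Q Pbar Pn P0 : 'M[R]_n) (M : nat -> 'M[R]_n) :
  M 0%N = P0 ->
  (forall k, M k.+1 = (1 - pv) *: ((1 - pu) *: Pbar + pu *: Pn) +
     pv *: (A *m M k *m A^T + Q)) ->
  forall k, mx_mean_indep k (Peseq A Q Pbar Pn P0 v u k) (M k).
Proof.
move=> M0 MS; elim=> [|k IH]; first by rewrite M0; exact: mx_mean_indep_cst.
set F := fun t => A *m Peseq A Q Pbar Pn P0 v u k t *m A^T + Q.
have HF : mx_mean_indep k F (A *m M k *m A^T + Q) by exact: mx_mean_indep_congr.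
(* Inclusion-exclusion over successes: start from [F], switch to [Pn] when [v] succeeds, then from
   [Pn] to [Pbar] when [u] succeeds too. *)
have -> : Peseq A Q Pbar Pn P0 v u k.+1 = fun t =>
    (t \in cylinder [:: k] [:: k])%:R *: (Pbar - Pn) +
    ((t \in cylinder [::] [:: k])%:R *: (Pn + (-1) *: F t) + F t).
  apply/funext => t /=; rewrite !mem_cylinder /= !andbT.
  case: (v k t); rewrite ?andbT ?andbF; case: (u k t);
    rewrite !(scale1r, scale0r) ?add0r // ?scaleN1r ?subrK //.
have -> : M k.+1 = ((1 - pu) ^+ 1 * (1 - pv) ^+ 1) *: (Pbar - Pn) +
    (((1 - pu) ^+ 0 * (1 - pv) ^+ 1) *: (Pn + (-1) *: (A *m M k *m A^T + Q)) +
     (A *m M k *m A^T + Q)).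
  by rewrite MS; apply/matrixP => i j; rewrite !mxE; ring.
apply: mx_mean_indepD.
  apply: mx_mean_indep_restrict; rewrite /= ?eqxx //.
  exact: mx_mean_indep_cst.
apply: mx_mean_indepD; last exact: mx_mean_indepS.
apply: mx_mean_indep_restrict; rewrite /= ?eqxx //.
by apply: mx_mean_indepD; [exact: mx_mean_indep_cst|exact: mx_mean_indepZ].
Qed.

End Expectation.

(** * The gap between the Riccati solution and the open loop *)

Lemma observable_neq0 (R : realType) n m (A : 'M[R]_n) (C : 'M[R]_(m, n)) :
  (0 < n)%N -> observable A C -> C != 0.
Proof.
move=> n0 obs; apply/negP => /eqP C0; move: obs; rewrite /observable C0.
have -> : \mxcol_(i < n) ((0 : 'M[R]_(m, n)) *m A ^+ i) = 0.
  by apply/matrixP => i j; rewrite !mxE big1 // => l _; rewrite mxE mul0r.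
by rewrite mxrank0 => n00; rewrite -n00 in n0.
Qed.

(* The Riccati equation says [Pbar = prior - G] with [G] the positive
   semidefinite correction, so [POP - Pbar = L(A, G)]. *)
Lemma riccati_gap (R : realType) n m (A Q P POP : 'M[R]_n)
    (C : 'M[R]_(m, n)) (Rn : 'M[R]_m) :
  (0 < n)%N -> mx_cvg (fun k => A ^+ k) 0 -> pd_mx Q -> pd_mx Rn ->
  observable A C -> pd_mx P -> riccati A Q C Rn P -> is_L A Q POP ->
  nonneg_form (POP - P) /\ 0 < \tr (POP - P).
Proof.
move=> n0 A0 [symQ Q0] [symR R0] obs [symP P0] ric LPOP.
set N := prior A Q P; set S := C *m N *m C^T + Rn.
have symN : N^T = N.
  by rewrite /N /prior linearD /= !trmx_mul trmxK symP symQ mulmxA.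
have N0 : pos_form N.
  apply: nonneg_pos_formD Q0; apply: nonneg_form_congr; exact: pos_form_nonneg.
have symS : S^T = S.
  by rewrite /S linearD /= !trmx_mul trmxK symN symR mulmxA.
have S0 : pos_form S.
  apply: nonneg_pos_formD R0; apply: nonneg_form_congr; exact: pos_form_nonneg.
pose B := N *m C^T; pose G := B *m invmx S *m B^T.
have iS0 := pos_form_inv symS S0.
(* [N] is invertible, so [N *m C^T = 0] would force [C = 0]. *)
have B0 : B != 0.
  apply: contra (observable_neq0 n0 obs) => /eqP B0.
  rewrite -trmx_eq0 -[C^T](mulKmx (pos_form_unitmx N0)).
  by rewrite -/B B0 mulmx0.
have G0 : nonneg_form G by apply: nonneg_form_congr; exact: pos_form_nonneg.
have LG : is_L A G (POP - P).
  rewrite /is_L mulmxBr mulmxBl {1}LPOP {1}ric -/N -/S.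
  have -> : N *m C^T *m invmx S *m C *m N = G.
    by rewrite /G /B trmx_mul trmxK symN !mulmxA.
  by rewrite /N /prior; apply/matrixP => i j; rewrite !mxE; ring.
split; first exact: is_L_nonneg LG G0.
by apply: lt_le_trans (is_L_mxtrace A0 LG G0); exact: mxtrace_congr_pos.
Qed.

(** * Steady-state means and the threshold *)

Theorem theorem1 (R : realType) (n m : nat)
  (A Q Qh Pbar POP Pn We Se He P0 Pe0 : 'M[R]_n)
  (C : 'M[R]_(m, n)) (Rn : 'M[R]_m) (gbar ge mu : R)
  (d : measure_display) (T : measurableType d) (Pr : probability T R)
  (lam lame u : nat -> T -> bool) :
  (0 < n)%N ->
  spec_rad_lt1 A ->
  pd_mx Q -> pd_mx Rn ->
  observable A C ->
  psd_mx Qh -> Qh *m Qh = Q -> controllable A Qh ->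
  pd_mx Pbar -> riccati A Q C Rn Pbar -> stabilizing A Q C Rn Pbar ->
  is_L A Q POP -> Pn = POP + Pbar ->
  0 <= gbar < 1 -> 0 <= ge < 1 -> 0 < mu < 1 ->
  iid_bernoulli Pr lam gbar -> iid_bernoulli Pr lame ge -> iid_bernoulli Pr u mu ->
  indep_seqs Pr (fun k => [set t | u k t]) (fun k => [set t | lam k t]) ->
  indep_seqs Pr (fun k => [set t | u k t]) (fun k => [set t | lame k t]) ->
  psd_mx P0 -> psd_mx Pe0 ->
  is_L (Num.sqrt ge *: A) Pbar We ->
  is_L (Num.sqrt ge *: A) Q Se ->
  is_L (Num.sqrt ge *: A) Pn He ->
  (ge * (\tr Se - \tr We) + \tr We - \tr POP) / ((ge - 1) * (\tr He - \tr We)) < mu ->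
  exists Pinf Peinf : 'M[R]_n,
    [/\ Emx_cvg Pr (Pseq A Q Pbar P0 lam u) Pinf,
        Emx_cvg Pr (Peseq A Q Pbar Pn Pe0 lame u) Peinf,
        \tr Pinf < \tr POP & \tr POP < \tr Peinf].
Proof.
move=> n0 rhoA pdQ pdR obs _ _ _ pdP ric _ LPOP PnE.
move=> /andP[gb0 gb1] /andP[ge0 ge1] /andP[mu0 mu1].
move=> iidlam iidlame iidu indlam indlame _ _ LWe LSe LHe muOP.
have A0 := spec_rad_lt1_cvg0 rhoA.
have sqrtA q : 0 <= q <= 1 -> mx_cvg (fun k => (Num.sqrt q *: A) ^+ k) 0.
  by move=> /andP[q0 q1]; apply: mx_cvg0_scale A0; rewrite sqrtr_ge0 -sqrtr1 ler_sqrt.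
have [gap0 tr_gap] := riccati_gap n0 A0 pdQ pdR obs pdP ric LPOP.
(* The probability that the user's covariance is reset to [Pbar]. *)
pose s := (1 - mu) * (1 - gbar).
have s0 : 0 < s by rewrite /s; nra.
have s1 : s < 1 by rewrite /s; nra.
have q01 : 0 <= 1 - s <= 1 by apply/andP; split; lra.
have q0 : 0 <= 1 - s by lra.
have [Pinf LPinf] := is_L_exists (s *: Pbar + (1 - s) *: Q) (sqrtA _ q01).
(* Linearity of the Lyapunov solution in its source term gives this limit explicitly. *)
pose Peinf := (1 - ge) *: ((1 - mu) *: We + mu *: He) + ge *: Se.
have LPeinf : is_L (Num.sqrt ge *: A)
    ((1 - ge) *: ((1 - mu) *: Pbar + mu *: Pn) + ge *: Q) Peinf.
  exact/is_L_scaleD/LSe/is_L_scaleD.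
exists Pinf, Peinf; split.
- pose M k := iter k (fun X => s *: Pbar + (1 - s) *: (A *m X *m A^T + Q)) P0.
  apply: (mx_mean_indep_Emx (M := M)).
    exact: (mx_mean_indep_Pseq iidu iidlam indlam).
  apply: (is_L_iter (sqrtA _ q01) LPinf) => k.
  by rewrite /M iterS -/(M k) congr_sqrt // scalerDr addrCA.
- pose M k := iter k (fun X => (1 - ge) *: ((1 - mu) *: Pbar + mu *: Pn) +
    ge *: (A *m X *m A^T + Q)) Pe0.
  apply: (mx_mean_indep_Emx (M := M)).
    exact: (mx_mean_indep_Peseq iidu iidlame indlame).
  have ge01 : 0 <= ge <= 1 by rewrite ge0 ltW.
  apply: (is_L_iter (sqrtA _ ge01) LPeinf) => k.
  by rewrite /M iterS -/(M k) congr_sqrt // [ge *: (_ *m _ + _)]scalerDr addrCA.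
- have LD : is_L (Num.sqrt (1 - s) *: A) (s *: (POP - Pbar)) (POP - Pinf).
    move: LPinf; rewrite /is_L !congr_sqrt // => LPinf.
    (* Writing [POP] as a convex combination of itself and its own update matches the damping
       [1 - s], leaving the source [s *: (POP - Pbar)]. *)
    rewrite {1}LPinf [X in X - _](_ : POP = s *: POP + (1 - s) *: (A *m POP *m A^T + Q)).
      by rewrite mulmxBr mulmxBl; apply/matrixP => i j; rewrite !mxE; ring.
    by rewrite -LPOP -scalerDl addrC subrK scale1r.
  have sgap0 : nonneg_form (s *: (POP - Pbar)).
    move=> v; rewrite -scalemxAr -scalemxAl mxE mulr_ge0 // ltW //.
  have := is_L_mxtrace (sqrtA _ q01) LD sgap0.
  rewrite mxtraceZ -subr_gt0 -[\tr POP - _]raddfB; apply: lt_le_trans.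
  by rewrite mulr_gt0.
- have ge01 : 0 <= ge <= 1 by rewrite ge0 ltW.
  have trPOP : 0 < \tr POP.
    apply: lt_le_trans (is_L_mxtrace A0 LPOP (pos_form_nonneg pdQ.2)).
    exact: mxtrace_pos pdQ.2.
  have POP0 := is_L_nonneg A0 LPOP (pos_form_nonneg pdQ.2).
  have LHW : is_L (Num.sqrt ge *: A) POP (He - We).
    have := is_L_scaleD 1 (-1) LHe LWe.
    by rewrite !scale1r !scaleN1r PnE addrK.
  have := lt_le_trans trPOP (is_L_mxtrace (sqrtA _ ge01) LHW POP0).
  rewrite raddfB /= => HW0.
  (* The denominator is negative, because [ge < 1] and [HW0] holds, so clearing it reverses the
     inequality; the result is the claim up to rearrangement. *)
  move: muOP; rewrite ltr_ndivrMr; last nra.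
  rewrite /Peinf !(mxtraceD, mxtraceZ) => h.
  lra.
Qed.
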